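(* Let $\alpha$ be an algebraic number of degree $d$ over $\mathbb{Q}$, where $d\in\{4,5,6,7\}$. (i) There exist four distinct algebraic conjugates $\alpha_1,\alpha_2,\alpha_3,\alpha_4$ of $\alpha$ satisfying $$\alpha_{1}+\alpha_{2}+\alpha_{3}+\alpha_{4}=0$$ if and only if either $d=4$ and $tr(\alpha)=0$, or $d=6$ and the minimal polynomial of $\alpha$ over $\mathbb{Q}$ is an irreducible polynomial of the form $$x^{6}+ax^{4}+bx^{2}+c\in\mathbb{Q}[x].$$ (ii) No four distinct algebraic conjugates $\alpha_1,\alpha_2,\alpha_3,\alpha_4$ of $\alpha$ satisfy the relation $$\alpha_{1}+\alpha_{2}+\alpha_{3}=\alpha_{4}.$$
   Context: Algebraic numbers, algebraic conjugates, degree, minimal polynomials and irreducibility are all over $\mathbb{Q}$. The algebraic conjugates of $\alpha$ (including $\alpha$ itself) are the $d$ distinct complex roots of its minimal polynomial over $\mathbb{Q}$. The trace $tr(\alpha)$ is the absolute trace, i.e. the sum of all $d$ algebraic conjugates of $\alpha$. *)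

(* Defs.v *)
From mathcomp Require Import all_boot all_order all_algebra all_field.

Set Implicit Arguments.
Unset Strict Implicit.
Unset Printing Implicit Defensive.

Import GRing.Theory.
Local Open Scope ring_scope.

(* [algC] is the field of all algebraic numbers, so every complex root of a
   nonzero rational polynomial lies in it.  [minCpoly alpha] is the minimal
   polynomial of [alpha] over the rationals, with coefficients cast to [algC]. *)

Definition algdeg (alpha : algC) : nat := (size (minCpoly alpha)).-1.

(* [closed_field_poly_normal] lists roots with multiplicity, hence the [undup];
   [size_conjugates] shows that nothing is lost. *)
Definition conjugates (alpha : algC) : seq algC :=
  undup (sval (closed_field_poly_normal (minCpoly alpha))).

Definition abs_trace (alpha : algC) : algC := \sum_(z <- conjugates alpha) z.

Lemma conjugates_uniq (alpha : algC) : uniq (conjugates alpha).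
Proof. exact: undup_uniq. Qed.

Lemma mem_conjugates (alpha z : algC) :
  (z \in conjugates alpha) = root (minCpoly alpha) z.
Proof.
rewrite /conjugates mem_undup; case: closed_field_poly_normal => r /= ->.
by rewrite (monicP (minCpoly_monic alpha)) scale1r root_prod_XsubC.
Qed.

Lemma minCpoly_irreducible (alpha : algC) (p : {poly rat}) :
  minCpoly alpha = map_poly ratr p -> irreducible_poly p.
Proof.
move=> Dp; have [q [Dq /monic_neq0 nz_q] dv_q] := minCpolyP alpha.
have -> : p = q.
  by apply: (map_poly_inj (ratr : {rmorphism rat -> algC})); rewrite -Dq -Dp.
have q_alpha : root (map_poly ratr q) alpha by rewrite dv_q.
apply/(subfx_irreducibleP q_alpha nz_q) => r r_alpha nz_r.
by rewrite dvdp_leq // -dv_q.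
Qed.

Lemma size_conjugates (alpha : algC) : size (conjugates alpha) = algdeg alpha.
Proof.
have [p [Dp mon_p] _] := minCpolyP alpha.
have irr_p := minCpoly_irreducible Dp.
have sz_p : (1 < size p)%N by case: irr_p.
have nz_dp : p^`() != 0.
  apply/eqP => /(congr1 (fun r : {poly rat} => r`_(size p).-2)).
  have Dn : (size p).-2.+1 = (size p).-1 by case: (size p) sz_p => [|[]].
  rewrite coef_deriv coef0 Dn -lead_coefE (monicP mon_p) => /eqP.
  by rewrite Num.Theory.pnatr_eq0 /= -Dn.
have sep_p : separable_poly (minCpoly alpha).
  rewrite Dp separable_map unlock irreducible_poly_coprime //.
  by apply: contraL (lt_size_deriv (monic_neq0 mon_p)) => /(dvdp_leq nz_dp); rewrite -leqNgt.
rewrite /conjugates /algdeg; case: closed_field_poly_normal => r /= Dr.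
rewrite (monicP (minCpoly_monic alpha)) scale1r in Dr.
rewrite Dr separable_prod_XsubC in sep_p.
by rewrite Dr size_prod_XsubC undup_id.
Qed.

(* Main.v *)
From HB Require Import structures.
From mathcomp Require Import all_boot all_order all_algebra all_fingroup all_solvable all_field.
From mathcomp Require Import ring.
Require Import Defs.
Set Implicit Arguments.
Unset Strict Implicit.
Unset Printing Implicit Defensive.
Import Order.TTheory GRing.Theory Num.Theory.
Local Open Scope ring_scope.

(** Every relation with rational coefficients between conjugates is carried to
another one by the automorphisms of the field of algebraic numbers, which
permute the conjugates transitively ([conjugates_transitive]) and fix the
trace t.  Subtracting the relation from the trace moves attention to the few
conjugates that remain, and each degree is then settled as follows.

Prime degree (5 and 7).  The Galois group has order divisible by the degree p,
so it contains an automorphism that permutes the conjugates in a single cycle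
([prime_degree_cycle]).  The relation then says that the cyclic
cross-correlation of the coefficient vector c with the vector of conjugates
vanishes, so for each primitive p-th root of unity w either the discrete
Fourier transform of the conjugates is zero at w or that of c is zero at the
inverse of w.  The transform of c is a rational polynomial in the root, and the
primitive p-th roots are conjugate, so it vanishes at all of them or at none.
A vector whose transform vanishes at all of them is constant.  The conjugates
are distinct, so it is c that is constant ([prime_degree_relation]); this
excludes relations in which some conjugate is missing and another is present.

Degree 4.  A sum of all four conjugates is the trace.  If three of them sum to
the fourth, t is twice the fourth, which is therefore fixed by all
automorphisms; transitivity contradicts distinctness.

Degree 6, zero sum.  The remaining two conjugates x, y satisfy x + y = t.  By
transitivity z |-> t - z permutes the conjugates; summing over them gives
t = 6 t - t, hence t = 0.  So the conjugates come in opposite pairs, which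
means that the minimal polynomial is even ([conjugates_opp_closed],
[degree6_even_form]).  Conversely two opposite pairs have sum zero.

Degree 6, three summing to the fourth.  Now 2 a + y + z = t with y, z the
remaining two.  By transitivity a may be replaced by a conjugate x farthest
from t/4.  Then x - t/4 is, up to sign, the midpoint of two complex numbers of
no larger modulus, and strict convexity of the disc forces these to be equal,
against y <> z ([no_conjugate_midpoint]). *)

(** * Conjugates and the Galois group *)

Lemma minCpoly_prod (alpha : algC) :
  minCpoly alpha = \prod_(z <- conjugates alpha) ('X - z%:P).
Proof.
rewrite [LHS](@all_roots_prod_XsubC _ _ (conjugates alpha)).
- by rewrite (monicP (minCpoly_monic alpha)) scale1r.
- rewrite size_conjugates /algdeg prednK //.
  by rewrite lt0n size_poly_eq0 minCpoly_eq0.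
- by apply/allP => z; rewrite mem_conjugates.
- by rewrite uniq_rootsE conjugates_uniq.
Qed.

Lemma mem_conjugates_self (alpha : algC) : alpha \in conjugates alpha.
Proof. by rewrite mem_conjugates root_minCpoly. Qed.

Lemma conjugates_aut (alpha z : algC) (nu : {rmorphism algC -> algC}) :
  z \in conjugates alpha -> nu z \in conjugates alpha.
Proof.
rewrite !mem_conjugates; have [p [-> _] _] := minCpolyP alpha => z0.
have ->: map_poly ratr p = map_poly nu (map_poly (ratr : rat -> algC) p).
  by rewrite -map_poly_comp; apply: eq_map_poly => a /=; rewrite fmorph_rat.
by rewrite fmorph_root.
Qed.

Lemma abs_trace_rat (alpha : algC) : exists t : rat, abs_trace alpha = ratr t.
Proof.
have [p [Dp _] _] := minCpolyP alpha.
exists (- p`_(size (conjugates alpha)).-1).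
rewrite rmorphN /= -coef_map -Dp minCpoly_prod coefPn_prod_XsubC ?opprK //.
by rewrite size_eq0; have := mem_conjugates_self alpha; case: conjugates.
Qed.

(** Access to the Galois theory of abstract number fields: generating a field by
all the conjugates makes it a splitting field of the minimal polynomial. *)
Lemma conjugates_splitting_field (alpha : algC) :
  exists (L : splittingFieldType rat) (LC : {rmorphism L -> algC}) (s : seq L),
    map LC s = conjugates alpha /\ <<1 & s>>%VS = fullv.
Proof.
have [L0 [LC [s Ds genL]]] := num_field_exists (conjugates alpha).
have [p [Dp _] _] := minCpolyP alpha.
have LCp : map_poly LC (map_poly (in_alg L0) p) = minCpoly alpha.
  rewrite Dp -map_poly_comp; apply: eq_map_poly => a /=.
  by rewrite alg_num_field fmorph_rat.
have splitL : SplittingField.axiom L0.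
  exists (map_poly (in_alg L0) p).
    by apply/polyOver1P; exists p.
  exists s => //; rewrite -(eqp_map LC) LCp minCpoly_prod -Ds big_map.
  rewrite rmorph_prod /= [X in _ %= X](_ : _ = \prod_(j <- s) ('X - (LC j)%:P)) ?eqpxx //.
  by apply: eq_bigr => z _; rewrite map_polyXsubC.
pose splitM := FieldExt_isSplittingField.Build rat L0 splitL.
pose L : splittingFieldType rat := HB.pack L0 splitM.
by exists L, LC, s.
Qed.

Lemma map_minPoly (L : fieldExtType rat) (LC : {rmorphism L -> algC}) (a : L) :
  map_poly LC (minPoly 1 a) = minCpoly (LC a).
Proof.
have LCin (q : {poly rat}) :
    map_poly LC (map_poly (in_alg L) q) = map_poly ratr q.
  rewrite -map_poly_comp; apply: eq_map_poly => c /=.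
  by rewrite alg_num_field fmorph_rat.
have [p [Dp mon_p] dv_p] := minCpolyP (LC a).
have /polyOver1P[q Dq] := minPolyOver 1 a.
apply/eqP; rewrite -eqp_monic ?map_monic ?monic_minPoly ?minCpoly_monic //.
apply/andP; split.
  rewrite Dp -LCin dvdp_map minPoly_dvdp //.
    by apply/polyOver1P; exists p.
  by rewrite -(fmorph_root LC) LCin -Dp root_minCpoly.
rewrite Dp Dq LCin dvdp_map -dv_p -LCin fmorph_root -Dq.
exact: root_minPoly.
Qed.

Lemma minCpoly_conjugate (alpha z : algC) :
  z \in conjugates alpha -> minCpoly z = minCpoly alpha.
Proof.
rewrite mem_conjugates.
have [p [Dp mon_p] _] := minCpolyP alpha; have [q [Dq mon_q] dv_q] := minCpolyP z.
rewrite Dp dv_q => q_dv_p; have [_ irr_p] := minCpoly_irreducible Dp.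
have szq : size q != 1%N.
  rewrite -(size_map_poly (ratr : rat -> algC)) -Dq.
  by rewrite gtn_eqF ?size_minCpoly.
have := irr_p q szq q_dv_p; rewrite eqp_monic // => /eqP <-.
exact: Dq.
Qed.

Lemma gal_extend_algC (L : splittingFieldType rat) (LC : {rmorphism L -> algC})
    (x : gal_of {:L}) :
  exists nu : {rmorphism algC -> algC}, forall y, nu (LC y) = LC (x y).
Proof.
have xM : monoid_morphism x by apply/kHom_monoid_morphism/k1AHom.
pose xMM := GRing.isMonoidMorphism.Build _ _ (fun_of_lfun x) xM.
pose xRM : {rmorphism L -> L} := HB.pack (fun_of_lfun x) xMM.
by have [nu Dnu] := extend_algC_subfield_aut LC xRM; exists nu => y; rewrite -Dnu.
Qed.

(** An abstract automorphism of the splitting field sends one root of an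
irreducible polynomial to another; [gal_extend_algC] extends it to all
algebraic numbers. *)
Lemma conjugates_transitive (alpha y z : algC) :
    y \in conjugates alpha -> z \in conjugates alpha ->
  exists nu : {rmorphism algC -> algC}, nu y = z.
Proof.
have [L [LC [s [Ds _]]]] := conjugates_splitting_field alpha.
rewrite -Ds => /mapP[a a_s ->{y}] /mapP[b b_s ->{z}].
have Ca : LC a \in conjugates alpha by rewrite -Ds map_f.
have Cb : LC b \in conjugates alpha by rewrite -Ds map_f.
have ab : root (minPoly 1 a) b.
  by rewrite -(fmorph_root LC) map_minPoly (minCpoly_conjugate Ca) -mem_conjugates.
have [x _ xa] := normalField_root_minPoly (sub1v _) (normalFieldf 1) (memvf a) ab.
by have [nu Dnu] := gal_extend_algC LC x; exists nu; rewrite Dnu xa.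
Qed.

(** The lengths after which the iteration returns to [z] are closed under gcd,
and a prime is coprime to every smaller positive length. *)
Lemma uniq_traject_prime (T : eqType) (f : T -> T) (z : T) (p : nat) :
  prime p -> iter p f z = z -> f z != z -> uniq (traject f z p).
Proof.
move=> pr_p fpz fz.
have per k : iter (k * p) f z = z by elim: k => //= k IHk; rewrite iterD IHk.
have no_short m : (0 < m < p)%N -> iter m f z != z.
  case/andP=> m_gt0 m_lt_p; apply: contraNneq fz => fmz.
  have perm k : iter (k * m) f z = z by elim: k => //= k IHk; rewrite iterD IHk.
  case: (egcdnP p m_gt0) => km kn Dkm _; rewrite -[in eqbRHS](perm km) Dkm.
  have /eqP->: coprime m p by rewrite coprime_sym prime_coprime // gtnNdvd.
  by rewrite addn1 iterS per.
apply/(uniqP z) => i j; rewrite !inE size_traject => ltip ltjp.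
rewrite !nth_traject //.
wlog ltij : i j ltip ltjp / (i < j)%N => [IH eq_ij|].
  by case: (ltngtP i j) => // ltij; [apply: IH | apply/esym/IH].
move=> eq_ij; have := no_short (j - i)%N.
rewrite subn_gt0 ltij (leq_ltn_trans (leq_subr _ _) ltjp) => /(_ isT)/eqP[].
rewrite -[in LHS]fpz -iterD addnC -(subnK (ltnW ltip)) -addnA subnKC ?(ltnW ltij) //.
by rewrite iterD -eq_ij -iterD subnK ?fpz // ltnW.
Qed.

(** The degree divides the order of the Galois group, so by Cauchy's theorem a
prime degree d is the order of some automorphism.  It moves a root, whose
orbit then has exactly d elements. *)
Lemma prime_degree_cycle (alpha : algC) :
    prime (algdeg alpha) ->
  exists (nu : {rmorphism algC -> algC}) (z : algC),
    iter (algdeg alpha) nu z = z /\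
    perm_eq (conjugates alpha) (traject nu z (algdeg alpha)).
Proof.
set d := algdeg alpha => pr_d.
have [L [LC [s [Ds genL]]]] := conjugates_splitting_field alpha.
have [a a_s Da] : exists2 a, a \in s & alpha = LC a.
  by apply/mapP; rewrite Ds mem_conjugates_self.
have galL : galois 1 {:L}.
  rewrite /galois sub1v normalFieldf andbT /=.
  by apply/separableP => b _; apply/pcharf0_separable => q; rewrite pchar_lalg pchar_num.
have d_dvd : (d %| #|'Gal({:L} / 1)%g|)%N.
  rewrite -galois_dim // dimv1 divn1.
  have ->: d = \dim <<1; a>>.
    rewrite dim_Fadjoin dimv1 muln1 /d /algdeg Da -map_minPoly size_map_poly.
    by rewrite size_minPoly.
  exact/field_dimS/subvf.
have [x _ ox] := Cauchy pr_d d_dvd.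
have [nu Dnu] := gal_extend_algC LC x.
have iter_nu n b : iter n nu (LC b) = LC ((x ^+ n)%g b).
  elim: n => [|n IHn] /=; first by rewrite expg0 gal_id.
  by rewrite IHn Dnu expgSr galM ?memvf.
have [b b_s xb] : exists2 b, b \in s & x b != b.
  apply/hasP; apply: contraT; rewrite -all_predC => /allP fix_s.
  have: x == 1%g.
    have fix_L : ({:L} <= fixedField [set x])%VS.
      rewrite -[X in (X <= _)%VS]genL; apply/Fadjoin_seqP; split=> [|c c_s]; first exact: sub1v.
      apply/fixedFieldP => [|y /set1P->]; first exact: memvf.
      by apply/eqP; have:= fix_s c c_s; rewrite /= negbK.
    apply/gal_eqP => c c_L; rewrite gal_id.
    by apply: (fixedFieldP c_L (subvP fix_L c c_L)); rewrite set11.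
  by rewrite -order_eq1 ox gtn_eqF ?prime_gt1.
exists nu, (LC b); split; first by rewrite iter_nu -ox expg_order gal_id.
have nu_b n : iter n nu (LC b) \in conjugates alpha.
  by elim: n => [|n IHn] /=; [rewrite -Ds map_f | exact: conjugates_aut].
have uniq_b : uniq (traject nu (LC b) d).
  apply: uniq_traject_prime => //; first by rewrite iter_nu -ox expg_order gal_id.
  by rewrite Dnu (inj_eq (fmorph_inj LC)).
rewrite perm_sym; apply: uniq_perm; rewrite ?conjugates_uniq //.
have [||_ eq_b] := uniq_min_size uniq_b (s2 := conjugates alpha).
- by move=> _ /trajectP[n _ ->].
- by rewrite size_conjugates size_traject.
- exact: eq_b.
Qed.

(** * Linear relations between conjugates in prime degree *)

(** The polynomials 1 + X + ... + X^(p-1) and sum of a i X^i both vanish at the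
p - 1 primitive roots.  Subtracting a (p-1) times the former from the latter
cancels the leading terms and leaves a polynomial of degree below p - 1 with
p - 1 roots. *)
Lemma const_of_primitive_roots (p : nat) (a : nat -> algC) :
    prime p ->
    (forall w, p.-primitive_root w -> \sum_(i < p) a i * w ^+ i = 0) ->
  forall i, (i < p)%N -> a i = a p.-1.
Proof.
case: p => // n pr_p a0 i /= le_in.
have [v prim_v] := C_prim_root_exists (ltn0Sn n).
pose rs := [seq v ^+ j.+1 | j <- iota 0 n].
have prim_rs w : w \in rs -> n.+1.-primitive_root w.
  case/mapP => j; rewrite mem_iota /= => lt_jn ->.
  by rewrite prim_root_exp_coprime // coprime_sym prime_coprime ?gtnNdvd.
have uniq_rs : uniq rs.
  rewrite map_inj_in_uniq ?iota_uniq // => j1 j2; rewrite !mem_iota /= => lt1 lt2.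
  by move/eqP; rewrite (eq_prim_root_expr prim_v) !modn_small // => /eqP[].
pose q := \poly_(j < n) (a j - a n).
have q0 : q = 0.
  apply: contraTeq (leqnn n) => nz_q; rewrite -ltnNge.
  have -> : n = size rs by rewrite size_map size_iota.
  apply: leq_trans (max_poly_roots nz_q _ uniq_rs) _; last first.
    by rewrite size_map size_iota size_poly.
  apply/allP => w /prim_rs prim_w.
  have geo : \sum_(j < n.+1) w ^+ j = 0.
    apply: (mulfI (x := w - 1)).
      by rewrite subr_eq0 -[w]expr1 -(prim_order_dvd prim_w) dvdn1 gtn_eqF ?prime_gt1.
    by rewrite -subrX1 prim_expr_order // subrr mulr0.
  apply/eqP; transitivity (\sum_(j < n.+1) (a j - a n) * w ^+ j).
    by rewrite horner_poly big_ord_recr /= subrr mul0r addr0.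
  under eq_bigr do rewrite mulrBl.
  by rewrite sumrB a0 // -mulr_sumr geo mulr0 subrr.
have [->//|neq_in] := eqVneq i n.
have := coef_poly n (fun j => a j - a n) i.
rewrite -/q q0 coef0 ltn_neqAle neq_in -ltnS le_in => /esym/eqP.
by rewrite subr_eq0 => /eqP.
Qed.

(** Irreducibility of the cyclotomic polynomials. *)
Lemma rat_root_primitive (f : {poly rat}) (p : nat) (v w : algC) :
    p.-primitive_root v -> p.-primitive_root w ->
  root (map_poly ratr f) v -> root (map_poly ratr f) w.
Proof.
move=> prim_v prim_w; have [q [Dq _] ->] := minCpolyP v => /dvdpP[r ->].
by rewrite rmorphM rootM /= -Dq (minCpoly_cyclotomic prim_v) root_cyclotomic // prim_w orbT.
Qed.

(** The hypothesis on [c] and [a] is the vanishing of their cyclic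
cross-correlation, so at each primitive root [w] the transform of [a] at [w]
times that of [c] at the inverse of [w] is zero. *)
Lemma cyclic_relation_const (p : nat) (c : nat -> rat) (a : nat -> algC) :
    prime p -> (forall i, a (i + p)%N = a i) -> a 0%N != a 1%N ->
    (forall m, \sum_(i < p) ratr (c i) * a (m + i)%N = 0) ->
  forall i, (i < p)%N -> c i = c p.-1.
Proof.
move=> pr_p a_per a01 rel i lt_ip; apply: (fmorph_inj (ratr : {rmorphism rat -> algC})).
pose f := \poly_(j < p) c j.
have fE w : (map_poly ratr f).[w] = \sum_(j < p) ratr (c j) * w ^+ j :> algC.
  rewrite (@horner_coef_wide _ p) ?size_map_poly ?size_poly //.
  by apply: eq_bigr => j _; rewrite coef_map coef_poly ltn_ord.
have [v prim_v] := C_prim_root_exists (prime_gt0 pr_p).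
have [fv|nz_fv] := boolP (root (map_poly ratr f) v).
  apply: (const_of_primitive_roots (a := fun j => ratr (c j))) => // w prim_w.
  by rewrite -fE; apply/eqP/(rat_root_primitive prim_v).
have dft0 w : p.-primitive_root w -> \sum_(m < p) a m * w ^+ m = 0.
  move=> prim_w; have wp := prim_expr_order prim_w.
  have shift j : \sum_(m < p) a (m + j)%N * w ^+ (m + j) = \sum_(m < p) a m * w ^+ m.
    elim: j => [|j <-]; first by apply: eq_bigr => m _; rewrite addn0.
    case: p pr_p a_per wp {prim_w v f fE prim_v nz_fv rel lt_ip} => // n _ a_per wp.
    rewrite big_ord_recr [RHS]big_ord_recl /= addrC; congr (_ + _).
      by rewrite addnS -addSn addnC a_per exprD wp mulr1.
    by apply: eq_bigr => m _; rewrite /bump /= add1n addSnnS.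
  (* [w ^+ p.-1] is the inverse of [w]. *)
  have prim_w' : p.-primitive_root (w ^+ p.-1).
    by rewrite prim_root_exp_coprime // coprimePn ?prime_gt0.
  apply: (mulfI (x := (map_poly ratr f).[w ^+ p.-1])).
    by apply: contra nz_fv => /(rat_root_primitive prim_w' prim_v).
  rewrite mulr0 fE mulr_suml.
  transitivity (\sum_(m < p) w ^+ m * \sum_(j < p) ratr (c j) * a (m + j)%N).
    under [RHS]eq_bigr do rewrite mulr_sumr.
    rewrite exchange_big /=; apply: eq_bigr => j _.
    rewrite -(shift j) mulr_sumr; apply: eq_bigr => m _.
    have ww : (w ^+ p.-1) ^+ j * w ^+ j = 1.
      by rewrite -exprMn -exprSr prednK ?prime_gt0 // wp expr1n.
    have -> : ratr (c j) * (w ^+ p.-1) ^+ j * (a (m + j)%N * w ^+ (m + j)) =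
        w ^+ m * (ratr (c j) * a (m + j)%N) * ((w ^+ p.-1) ^+ j * w ^+ j).
      by rewrite exprD; ring.
    by rewrite ww mulr1.
  by apply: big1 => m _; rewrite rel mulr0.
have a_const := const_of_primitive_roots pr_p dft0.
by case/eqP: a01; rewrite !a_const ?prime_gt0 ?prime_gt1.
Qed.

(** Only the trivial relations exist: those proportional to the vanishing of the
trace. *)
Lemma prime_degree_relation (alpha : algC) (k : algC -> rat) :
    prime (algdeg alpha) ->
    \sum_(z <- conjugates alpha) ratr (k z) * z = 0 ->
  {in conjugates alpha &, forall x y, k x = k y}.
Proof.
set d := algdeg alpha => pr_d.
have [nu [z [nu_d cycle]]] := prime_degree_cycle pr_d; rewrite -/d in nu_d cycle.
pose a i := iter i nu z.
rewrite (perm_big _ cycle) /= (big_nth z) size_traject big_mkord => rel0.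
have rel m : \sum_(i < d) ratr (k (a i)) * a (m + i)%N = 0.
  elim: m => [|m IHm].
    by rewrite -[RHS]rel0; apply: eq_bigr => i _; rewrite nth_traject.
  have /(congr1 nu) := IHm; rewrite rmorph0 rmorph_sum /= => nu_rel.
  rewrite -[RHS]nu_rel.
  apply: eq_bigr => i _.
  by rewrite rmorphM /= fmorph_rat.
have a_per i : a (i + d)%N = a i by rewrite /a iterD nu_d.
have a01 : a 0%N != a 1%N.
  have: uniq (traject nu z d) by rewrite -(perm_uniq cycle) conjugates_uniq.
  by case: (d) (prime_gt1 pr_d) => [|[|n]] //= _; rewrite inE negb_or => /andP[/andP[]].
have k_const := cyclic_relation_const (c := fun i => k (a i)) pr_d a_per a01 rel.
move=> x y; rewrite !(perm_mem cycle) => /trajectP[i lt_i ->] /trajectP[j lt_j ->].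
by rewrite (k_const i lt_i) (k_const j lt_j).
Qed.

Lemma uniq_subset_perm_cat (T : eqType) (s t : seq T) :
  uniq s -> uniq t -> {subset s <= t} ->
  perm_eq t (s ++ [seq x <- t | x \notin s]).
Proof.
move=> uniq_s uniq_t st; rewrite -(perm_filterC (mem s) t) perm_cat2r.
apply: uniq_perm; rewrite ?filter_uniq // => x; rewrite mem_filter /=.
by apply: andb_idr => /st.
Qed.

(** A conjugate outside [s] has coefficient 0, hence so have all the others. *)
Lemma prime_degree_no_short_relation (alpha : algC) (s : seq algC)
    (e : algC -> rat) :
    prime (algdeg alpha) -> uniq s -> {subset s <= conjugates alpha} ->
    (size s < algdeg alpha)%N -> \sum_(z <- s) ratr (e z) * z = 0 ->
  forall z, z \in s -> e z = 0.
Proof.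
move=> pr_d uniq_s s_conj lt_sd rel z z_s.
have perm := uniq_subset_perm_cat uniq_s (conjugates_uniq alpha) s_conj.
have /hasP[y y_conj s'y] : has [predC s] (conjugates alpha).
  apply: contraLR lt_sd; rewrite -all_predC -leqNgt => /allP sub.
  rewrite -size_conjugates; apply: uniq_leq_size (conjugates_uniq _) _ => x /sub /=.
  by rewrite negbK.
pose k x := if x \in s then e x else 0.
have: k z = k y.
  apply: (prime_degree_relation pr_d) => //; last exact: s_conj.
  rewrite (perm_big _ perm) big_cat /= big_filter [X in _ + X]big1; last first.
    by move=> x /negbTE s'x; rewrite /k s'x rmorph0 mul0r.
  by rewrite addr0 -[RHS]rel; apply: eq_big_seq => x x_s; rewrite /k x_s.
by rewrite /k z_s (negbTE s'y).
Qed.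

(** * Degree 6: a conjugate as a reflected midpoint *)

(** Strict convexity of the disc of radius |w|. *)
Lemma norm_midpoint (u v w : algC) :
  `|u| <= `|w| -> `|v| <= `|w| -> u + v = - (w + w) -> u = v.
Proof.
move=> le_uw le_vw uvw.
have norm_uv : `|u + v| = `|w| + `|w| by rewrite uvw normrN -mulr2n normrMn mulr2n.
have sum_uv : `|u| + `|v| = `|w| + `|w|.
  by apply/le_anti; rewrite lerD //= -norm_uv ler_normD.
have eq_uw : `|u| = `|w|.
  apply/le_anti; rewrite le_uw /= -(lerD2r `|v|) sum_uv lerD2l //.
have eq_vw : `|v| = `|w| by apply: (addrI `|u|); rewrite sum_uv eq_uw.
have [t _ [-> ->]] : {t : algC | `|t| == 1 & (u, v) = (`|u| * t, `|v| * t)}.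
  by apply: normCDeq; rewrite norm_uv sum_uv.
by rewrite eq_uw eq_vw.
Qed.

Lemma extremal_conjugate (alpha c : algC) :
  exists2 x, x \in conjugates alpha &
    forall y, y \in conjugates alpha -> `|y - c| <= `|x - c|.
Proof.
pose T := seq_sub (conjugates alpha).
pose x0 : T := SeqSub (mem_conjugates_self alpha).
have real_norm : {in predT, forall z : T, `|val z - c| \is Num.real}.
  by move=> z _; apply: normr_real.
have [x _ x_max] := @real_arg_maxP _ T x0 predT _ isT real_norm.
exists (val x) => [|y y_conj]; first exact: valP.
exact: (x_max (SeqSub y_conj)).
Qed.

(** After translating by t/4 the relation says that twice an extremal conjugate
is minus the sum of two others, which [norm_midpoint] makes equal. *)
Lemma no_conjugate_midpoint (alpha a y z : algC) (t : rat) :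
    [/\ a \in conjugates alpha, y \in conjugates alpha & z \in conjugates alpha] ->
    y != z -> a + a + y + z = ratr t -> False.
Proof.
case=> a_conj y_conj z_conj neq_yz rel.
have [x x_conj x_max] := extremal_conjugate alpha (ratr t / 4).
have [nu nu_a] := conjugates_transitive a_conj x_conj.
have /(congr1 nu) := rel; rewrite !rmorphD /= nu_a fmorph_rat => rel_x.
case/eqP: neq_yz; apply: (fmorph_inj nu).
apply: (addIr (- (ratr t / 4))).
apply: norm_midpoint (x_max _ (conjugates_aut nu y_conj))
  (x_max _ (conjugates_aut nu z_conj)) _.
by rewrite -rel_x; field.
Qed.

(** * Degree 6: opposite conjugates and even polynomials *)

(** The reflection z |-> t - z permutes the conjugates because some automorphism
sends [x] to z and then [y] to t - z.  Summing over the d conjugates gives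
2 t = d t, hence t = 0. *)
Lemma conjugates_opp_closed (alpha x y : algC) :
    algdeg alpha != 2%N ->
    x \in conjugates alpha -> y \in conjugates alpha ->
    x + y = abs_trace alpha ->
  {in conjugates alpha, forall z, - z \in conjugates alpha}.
Proof.
move=> d2 x_conj y_conj xy.
have [t Dt] := abs_trace_rat alpha.
have refl z : z \in conjugates alpha -> ratr t - z \in conjugates alpha.
  move=> z_conj; have [nu nu_x] := conjugates_transitive x_conj z_conj.
  have <- : nu y = ratr t - z.
    rewrite -nu_x -(fmorph_rat nu t) -rmorphB -Dt -xy.
    by rewrite [x + y]addrC addrK.
  exact: conjugates_aut.
suff t0 : ratr t = 0 :> algC by move=> z /refl; rewrite t0 sub0r.
have perm : perm_eq (conjugates alpha) [seq ratr t - z | z <- conjugates alpha].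
  have inj : injective (fun z : algC => ratr t - z) by move=> u v /addrI/oppr_inj.
  rewrite perm_sym; apply: uniq_perm; rewrite ?map_inj_uniq ?conjugates_uniq // => z.
  apply/mapP/idP => [[u /refl u_conj -> //]|/refl z_conj].
  by exists (ratr t - z) => //; rewrite opprB addrC subrK.
have /eqP : (ratr t *+ 2 : algC) = ratr t *+ algdeg alpha.
  rewrite mulr2n -[in LHS]Dt {1}/abs_trace (perm_big _ perm) big_map sumrB.
  rewrite -/(abs_trace alpha) Dt subrK big_const_seq count_predT size_conjugates.
  by rewrite iter_addr addr0.
rewrite -subr_eq0; case: (ltngtP 2 (algdeg alpha)) d2 => // lt_d _.
  by rewrite -opprB oppr_eq0 -mulrnBr ?(ltnW lt_d) // mulrn_eq0 subn_eq0 leqNgt lt_d => /eqP.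
by rewrite -mulrnBr ?(ltnW lt_d) // mulrn_eq0 subn_eq0 leqNgt lt_d => /eqP.
Qed.

(** For even degree, p(X) - p(-X) has smaller degree than p and vanishes at
[alpha], hence is zero. *)
Lemma minCpoly_even (alpha : algC) (p : {poly rat}) (i : nat) :
    {in conjugates alpha, forall z, - z \in conjugates alpha} ->
    ~~ odd (algdeg alpha) -> minCpoly alpha = map_poly ratr p -> odd i -> p`_i = 0.
Proof.
move=> opp_conj even_d Dp odd_i.
have [_ [/(etrans (esym Dp))/(map_poly_inj (ratr : {rmorphism rat -> algC})) <- _] dv_p] :=
  minCpolyP alpha.
have Dd : algdeg alpha = (size p).-1 by rewrite /algdeg Dp size_map_poly.
pose r := \poly_(j < (size p).-1) ((1 - (-1) ^+ j) * p`_j).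
have r_root : root (map_poly ratr r) alpha.
  have p0 z : z \in conjugates alpha -> \sum_(j < size p) ratr p`_j * z ^+ j = 0.
    rewrite mem_conjugates Dp => /eqP pz0; apply: etrans pz0.
    rewrite (@horner_coef_wide _ (size p)) ?size_map_poly //.
    by apply: eq_bigr => j _; rewrite coef_map.
  have := mem_conjugates_self alpha => alpha_conj.
  have diff0 := congr2 (fun u v => u - v) (p0 _ alpha_conj) (p0 _ (opp_conj _ alpha_conj)).
  rewrite /= subrr -sumrB in diff0.
  apply/eqP; apply: etrans diff0; rewrite (@horner_coef_wide _ (size p).-1); last first.
    by rewrite size_map_poly size_poly.
  have sz_p : size p = (size p).-1.+1.
    by rewrite prednK // -(size_map_poly (ratr : rat -> algC)) -Dp ltnW ?size_minCpoly.
  rewrite [in RHS]sz_p big_ord_recr /= exprNn -Dd -signr_odd (negbTE even_d) expr0.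
  rewrite mul1r subrr addr0; apply: eq_bigr => j _.
  rewrite coef_map coef_poly -Dd ltn_ord /= [(- alpha) ^+ j]exprNn.
  by rewrite rmorphM rmorphB rmorph1 rmorph_sign /=; ring.
have r0 : r = 0.
  apply: contraTeq (size_poly (size p).-1 _ : (size r <= _)%N) => nz_r.
  move: r_root; rewrite dv_p => /(dvdp_leq nz_r); rewrite -ltnNge.
  apply: leq_trans; rewrite ltn_predL -(size_map_poly (ratr : rat -> algC)) -Dp.
  by rewrite ltnW ?size_minCpoly.
have [lt_i|gt_i|Di] := ltngtP i (size p).-1.
- have := coef_poly (size p).-1 (fun j => (1 - (-1) ^+ j) * p`_j) i.
  rewrite -/r r0 coef0 lt_i -signr_odd odd_i expr1 opprK => /esym/eqP.
  by rewrite mulf_eq0 => /orP[|/eqP].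
- by rewrite nth_default // (leq_trans (leqSpred _)).
- by rewrite -Dd in Di; rewrite -Di odd_i in even_d.
Qed.

Lemma degree6_even_form (alpha : algC) :
    algdeg alpha = 6%N ->
    {in conjugates alpha, forall z, - z \in conjugates alpha} ->
  exists a b c : rat,
    let p : {poly rat} := 'X^6 + a *: 'X^4 + b *: 'X^2 + c%:P in
    irreducible_poly p /\ minCpoly alpha = map_poly ratr p.
Proof.
move=> d6 opp_conj; have [p [Dp mon_p] _] := minCpolyP alpha.
have sz_p : size p = 7%N.
  have := d6; rewrite /algdeg Dp size_map_poly.
  by case: (size p) => // n /= ->.
have odd0 i : odd i -> p`_i = 0 by apply: minCpoly_even Dp; rewrite ?d6.
exists p`_4, p`_2, p`_0; set q := (X in let p := X in _).
suff Dq : q = p by rewrite /= Dq; split=> //; apply: minCpoly_irreducible Dp.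
apply/polyP => i; rewrite !coefE.
case: i => [|[|[|[|[|[|[|i]]]]]]] /=; rewrite ?mulr0 ?mulr1 ?addr0 ?add0r //.
- by rewrite odd0.
- by rewrite odd0.
- by rewrite odd0.
- by have := monicP mon_p; rewrite lead_coefE sz_p.
- by rewrite nth_default ?sz_p.
Qed.

Lemma opp_closed_two_pairs (alpha : algC) :
    (4 <= algdeg alpha)%N ->
    {in conjugates alpha, forall z, - z \in conjugates alpha} ->
  exists a b : algC, uniq [:: a; - a; b; - b] /\
    {subset [:: a; - a; b; - b] <= conjugates alpha}.
Proof.
move=> d4 opp_conj; rewrite -size_conjugates in d4.
have short (s : seq algC) : (size s < size (conjugates alpha))%N ->
    exists2 z, z \in conjugates alpha & z \notin s.
  move=> lt_s; apply/hasP; apply: contraLR lt_s; rewrite -all_predC -leqNgt => /allP sub.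
  by apply: uniq_leq_size (conjugates_uniq _) _ => x /sub /=; rewrite negbK.
have [a a_conj a0] := short [:: 0] (ltn_trans (isT : 1 < 2)%N (ltnW d4)).
have [b b_conj] := short [:: 0; a; - a] d4.
rewrite !inE in a0 *; rewrite !negb_or => /and3P[b0 ba bNa].
have neqN (z : algC) : z != 0 -> z != - z.
  by move=> z0; rewrite -addr_eq0 -mulr2n mulrn_eq0.
exists a, b; split.
  rewrite /= !inE !negb_or !neqN // !eqr_opp -eqr_oppLR.
  by rewrite (eq_sym a b) (eq_sym (- a) b) ba bNa.
by apply/allP; rewrite /= a_conj b_conj !opp_conj.
Qed.

(** * The theorem *)

Lemma abs_trace_complement (alpha : algC) (s : seq algC) :
    uniq s -> {subset s <= conjugates alpha} ->
  exists r : seq algC, [/\ uniq r, {subset r <= conjugates alpha},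
    size r = (algdeg alpha - size s)%N &
    abs_trace alpha = \sum_(z <- s) z + \sum_(z <- r) z].
Proof.
move=> uniq_s s_conj.
have perm := uniq_subset_perm_cat uniq_s (conjugates_uniq alpha) s_conj.
exists [seq x <- conjugates alpha | x \notin s]; split.
- exact/filter_uniq/conjugates_uniq.
- by move=> z; rewrite mem_filter => /andP[].
- by rewrite -size_conjugates (perm_size perm) size_cat addKn.
- by rewrite /abs_trace (perm_big _ perm) big_cat.
Qed.

Theorem theorem1 (alpha : algC) (d : nat)
  (deg_alpha : algdeg alpha = d) (d_range : d \in [:: 4; 5; 6; 7]%N) :
  ((exists a1 a2 a3 a4 : algC,
      [/\ uniq [:: a1; a2; a3; a4],
          {subset [:: a1; a2; a3; a4] <= conjugates alpha}
        & a1 + a2 + a3 + a4 = 0])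
   <->
   (d = 4%N /\ abs_trace alpha = 0)
   \/ (d = 6%N /\
       exists a b c : rat,
         let p : {poly rat} := 'X^6 + a *: 'X^4 + b *: 'X^2 + c%:P in
         irreducible_poly p /\ minCpoly alpha = map_poly ratr p))
  /\
  ~ (exists a1 a2 a3 a4 : algC,
       [/\ uniq [:: a1; a2; a3; a4],
           {subset [:: a1; a2; a3; a4] <= conjugates alpha}
         & a1 + a2 + a3 = a4]).
Proof.
have d_cases : [\/ prime d /\ (4 < d)%N, d = 4%N | d = 6%N].
  by move: d_range; rewrite !inE => /or4P[]/eqP->;
     [constructor 2 | constructor 1 | constructor 3 | constructor 1].
split; first split.
- case=> a1 [a2 [a3 [a4 [uniq_a a_conj rel]]]].
  have [r [uniq_r r_conj sz_r tr]] := abs_trace_complement uniq_a a_conj.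
  rewrite !big_cons big_nil !addrA addr0 rel add0r deg_alpha /= in sz_r tr.
  case: d_cases => [[pr_d gt_d4]|d4|d6].
  + rewrite -deg_alpha in pr_d gt_d4.
    have /eqP : (1 : rat) = 0.
      apply: (prime_degree_no_short_relation (e := fun=> 1) pr_d
        uniq_a a_conj gt_d4 _ (mem_head _ _)).
      by rewrite !big_cons big_nil rmorph1 !mul1r addr0 !addrA.
    by rewrite oner_eq0.
  + left; split=> //; rewrite d4 in sz_r.
    by rewrite tr (size0nil sz_r) big_nil.
  + right; split=> //; rewrite d6 in sz_r deg_alpha.
    apply: degree6_even_form => //.
    case: r sz_r {uniq_r} r_conj tr => [|x [|y []]] // _ r_conj.
    rewrite !big_cons big_nil addr0 => tr.
    apply: (@conjugates_opp_closed _ x y) => //.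
    * by rewrite deg_alpha.
    * by apply: r_conj; rewrite mem_head.
    * by apply: r_conj; rewrite !inE eqxx orbT.
- case=> [[d4 tr0]|[d6 [a [b [c [_ Dp]]]]]].
    move: tr0 (conjugates_uniq alpha) (size_conjugates alpha); rewrite /abs_trace.
    rewrite deg_alpha d4; case: (conjugates alpha) => [|a1 [|a2 [|a3 [|a4 []]]]] // tr0 uniq_a _.
    exists a1, a2, a3, a4; split=> //.
    by rewrite !big_cons big_nil addr0 !addrA in tr0.
  have opp_conj : {in conjugates alpha, forall z, - z \in conjugates alpha}.
    have evalE z : (minCpoly alpha).[z] =
        z ^+ 6 + ratr a * z ^+ 4 + ratr b * z ^+ 2 + ratr c.
      rewrite Dp !rmorphD /= map_polyC !map_polyZ !map_polyXn.
      by rewrite !hornerD !hornerZ !hornerXn hornerC.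
    move=> z; rewrite !mem_conjugates !rootE !evalE => /eqP z0.
    by apply/eqP; apply: etrans z0; ring.
  have [|x [y [uniq_xy xy_conj]]] := opp_closed_two_pairs _ opp_conj.
    by rewrite deg_alpha d6.
  by exists x, (- x), y, (- y); split=> //; rewrite subrr add0r subrr.
case=> a1 [a2 [a3 [a4 [uniq_a a_conj rel]]]].
have [r [uniq_r r_conj sz_r tr]] := abs_trace_complement uniq_a a_conj.
have a1_conj : a1 \in conjugates alpha by apply: a_conj; rewrite mem_head.
have a4_conj : a4 \in conjugates alpha by apply: a_conj; rewrite !inE eqxx !orbT.
have neq_a14 : a1 != a4.
  by move: uniq_a; rewrite /= !inE !negb_or => /andP[/and3P[]].
rewrite !big_cons big_nil addr0 !addrA rel deg_alpha /= in sz_r tr.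
have [t Dt] := abs_trace_rat alpha; rewrite Dt in tr.
case: d_cases => [[pr_d gt_d4]|d4|d6].
+ rewrite -deg_alpha in pr_d gt_d4.
  pose e z : rat := if z == a4 then -1 else 1.
  have e1 : e a1 = 0.
    apply: (prime_degree_no_short_relation pr_d uniq_a a_conj gt_d4 _ (mem_head _ _)).
    move: uniq_a; rewrite /= !inE !negb_or => /and4P[/and3P[_ _ n14] /andP[_ n24] n34 _].
    rewrite !big_cons big_nil /e eqxx (negbTE n14) (negbTE n24) (negbTE n34).
    rewrite rmorphN !rmorph1 mulNr !mul1r addr0 !addrA.
    by apply/eqP; rewrite subr_eq0; apply/eqP.
  by have := oner_eq0 rat; rewrite -[LHS]/(1 == 0) -e1 /e (negbTE neq_a14) eqxx.
+ rewrite d4 in sz_r; rewrite (size0nil sz_r) big_nil addr0 in tr.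
  have [nu nu4] := conjugates_transitive a4_conj a1_conj.
  case/eqP: neq_a14; have /(congr1 nu) := tr; rewrite fmorph_rat rmorphD /= nu4 tr.
  by move/eqP; rewrite -!mulr2n eqrMn2r // => /eqP.
rewrite d6 in sz_r; case: r sz_r uniq_r r_conj tr => [|y [|z []]] // _ uniq_r r_conj.
rewrite !big_cons big_nil addr0 addrA => /esym rel_t.
apply: (@no_conjugate_midpoint alpha a4 y z t) rel_t.
  by split=> //; apply: r_conj; rewrite !inE eqxx ?orbT.
by move: uniq_r; rewrite /= inE andbT.
Qed.
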